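(* Let $p(x)$ and $q(x)$ be real polynomials of degree at most $2$ and at most $1$, respectively, and let $I \subseteq \mathbb{R}$ be an open interval (bounded or unbounded), the domain of definition of the equation $$ -(p(x) y'(x))' + q(x) y'(x) = \lambda y(x). $$ Assume that: (1) this equation on $I$ is a Sturm-Liouville problem with a discrete set of solutions $y_0, y_1, y_2, \dots$ corresponding to eigenvalues $0 = \lambda_0 < \lambda_1 < \lambda_2 < \cdots$; and (2) for every $n \in \mathbb{N}$, the solution $y_n$ corresponding to $\lambda_n$ is a polynomial of degree $n$. Let $n \ge 1$, and let $x_1 < \dots < x_n$ denote the zeros of $y_n$. Then for all initial values $x_1(0) < x_2(0) < \dots < x_n(0)$ in $I$, the system of ordinary differential equations $$ \frac{d}{dt} x_i(t) = -p(x_i(t)) \sum_{\substack{k=1 \\ k \neq i}}^{n} \frac{2}{x_k(t) - x_i(t)} + p'(x_i(t)) - q(x_i(t)), \qquad 1 \le i \le n, $$ has a solution for all $t > 0$, and $x_i(t) \to x_i$ as $t \to \infty$ for every $1 \le i \le n$. Moreover, there are a constant $c > 0$ (which may depend on $p$, $q$, $n$ and the initial values) and a number $\sigma_n \ge \lambda_n - \lambda_{n-1}$ such that $$ \max_{1 \le i \le n} |x_i(t) - x_i| \le c\, e^{-\sigma_n t} \qquad \text{for all } t \ge 0. $$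
   Context: ''Sturm-Liouville problem'' is meant in the classical sense, so that classical Sturm-Liouville theory applies on $I$: $p > 0$ on $I$, and with the weight $w > 0$ on $I$ determined (up to a constant factor) by $w'/w = -q/p$, the equation takes the form $-(p w y')' = \lambda w y$, which (with the appropriate boundary conditions, automatic for polynomials in the classical cases) defines a self-adjoint operator on $L^2(I, w\,dx)$ whose spectrum consists of the simple eigenvalues $0 = \lambda_0 < \lambda_1 < \cdots$ with eigenfunctions $y_0, y_1, \dots$; in particular $y_j$ has exactly $j$ zeros in $I$, all simple. Examples: Hermite ($p=1$, $q=x$, $I=\mathbb{R}$), Laguerre ($p=q=x$, $I=(0,\infty)$), Legendre ($p=1-x^2$, $q=0$, $I=(-1,1)$). *)

(* Defs.v *)
From HB Require Import structures.
From mathcomp Require Export all_boot all_order all_algebra.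
From mathcomp Require Export all_classical all_reals all_analysis.

Set Implicit Arguments.
Unset Strict Implicit.
Unset Printing Implicit Defensive.

Import Order.TTheory GRing.Theory Num.Theory.
Import numFieldNormedType.Exports.

Local Open Scope classical_set_scope.
Local Open Scope ring_scope.

Definition open_interval (R : realType) (I : set R) : Prop :=
  [/\ open I, is_interval I & I !=set0].

(* The equation -(p f')' + q f' = mu f, pointwise on I.  Functions are total
   on R; their values off I are irrelevant here and below. *)
Definition solves_on (R : realType) (p q : {poly R}) (I : set R)
    (mu : R) (f : R -> R) : Prop :=
  forall x, I x ->
    [/\ derivable f x 1,
        derivable (fun z => p.[z] * derive1 f z) x 1 &
        - derive1 (fun z => p.[z] * derive1 f z) x +
          q.[x] * derive1 f x = mu * f x].

(* With this weight the equation reads -(p w f')' = mu w f. *)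
Definition sl_weight (R : realType) (p q : {poly R}) (I : set R)
    (w : R -> R) : Prop :=
  forall x, I x ->
    [/\ 0 < w x, derivable w x 1 & derive1 w x / w x = - (q.[x] / p.[x])].

(* The space L^2(I, w dx); its elements are represented by functions, and
   equality in it is equality almost everywhere on I. *)
Definition L2 (R : realType) (I : set R) (w f : R -> R) : Prop :=
  measurable_fun I f /\
  (@lebesgue_measure R).-integrable I (fun x => (f x ^+ 2 * w x)%:E).

Definition L2_eq (R : realType) (I : set R) (f g : R -> R) : Prop :=
  {ae @lebesgue_measure R, forall x, I x -> f x = g x}.

Definition L2_dot (R : realType) (I : set R) (w f g : R -> R) : R :=
  \int[@lebesgue_measure R]_(x in I) (f x * g x * w x).

(* f lies in the domain of the maximal operator u |-> - (p w u')' / w, which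
   maps it to g: integrating - (p w f')' = w g says at once that p w f' is
   locally absolutely continuous on I and that the equation holds a.e. *)
Definition sl_maximal (R : realType) (p : {poly R}) (I : set R)
    (w f g : R -> R) : Prop :=
  (forall x, I x -> derivable f x 1) /\
  (forall a b, I a -> I b -> a <= b ->
     p.[b] * w b * derive1 f b - p.[a] * w a * derive1 f a =
     - \int[@lebesgue_measure R]_(x in `[a, b]) (g x * w x)).

(* An operator on L^2(I, w dx) is given by its graph A, where A u v means that
   (the class of) u is in the domain and is mapped to (the class of) v.
   A realization is a restriction of the maximal operator; the boundary
   conditions are encoded in its domain. *)
Definition sl_realization (R : realType) (p : {poly R}) (I : set R)
    (w : R -> R) (A : (R -> R) -> (R -> R) -> Prop) : Prop :=
  forall u v, A u v ->
    exists f, [/\ L2 I w u, L2 I w v, L2_eq I u f & sl_maximal p I w f v].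

(* Densely defined, and equal to its adjoint: u is in the domain with image v
   iff <v, f> = <u, g> for all (f, g) in the graph.  In particular A is
   linear, closed, and compatible with a.e. equality. *)
Definition self_adjoint (R : realType) (I : set R) (w : R -> R)
    (A : (R -> R) -> (R -> R) -> Prop) : Prop :=
  (forall h, L2 I w h -> (forall f g, A f g -> L2_dot I w h f = 0) ->
     L2_eq I h (fun=> 0)) /\
  (forall u v, A u v <->
     [/\ L2 I w u, L2 I w v &
         forall f g, A f g -> L2_dot I w v f = L2_dot I w u g]).

(* A - mu is a bijection from its domain onto L^2 with bounded inverse. *)
Definition resolvent_point (R : realType) (I : set R) (w : R -> R)
    (A : (R -> R) -> (R -> R) -> Prop) (mu : R) : Prop :=
  (exists C : R, forall u v, A u v ->
     L2_dot I w u u <=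
     C * L2_dot I w (fun x => v x - mu * u x) (fun x => v x - mu * u x)) /\
  (forall h, L2 I w h -> exists u, A u (fun x => h x + mu * u x)).

(* The spectrum of a self-adjoint operator is real, so only real spectral
   parameters need to be considered. *)
Definition in_spectrum (R : realType) (I : set R) (w : R -> R)
    (A : (R -> R) -> (R -> R) -> Prop) (mu : R) : Prop :=
  ~ resolvent_point I w A mu.

Definition simple_eigenpair (R : realType) (I : set R)
    (A : (R -> R) -> (R -> R) -> Prop) (mu : R) (f : R -> R) : Prop :=
  [/\ A f (fun x => mu * f x),
      ~ L2_eq I f (fun=> 0) &
      forall u, A u (fun x => mu * u x) ->
        exists c : R, L2_eq I u (fun x => c * f x)].

Definition sturm_liouville (R : realType) (p q : {poly R}) (I : set R)
    (lambda : nat -> R) (y : nat -> R -> R) : Prop :=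
  [/\ forall x, I x -> 0 < p.[x],
      lambda 0%N = 0,
      forall j, lambda j < lambda j.+1,
      forall j, solves_on p q I (lambda j) (y j) &
      exists (w : R -> R) (A : (R -> R) -> (R -> R) -> Prop),
        [/\ sl_weight p q I w,
            sl_realization p I w A,
            self_adjoint I w A,
            forall mu, in_spectrum I w A mu <-> exists j, mu = lambda j &
            forall j, simple_eigenpair I A (lambda j) (y j)]].

Definition polynomial_of_degree_on (R : realType) (I : set R) (d : nat)
    (f : R -> R) : Prop :=
  exists P : {poly R}, size P = d.+1 /\ forall x, I x -> f x = P.[x].

(* X is a solution on [0, +oo[ with values in I; the points must stay distinct
   for the right-hand side to be defined. *)
Definition zero_flow (R : realType) (p q : {poly R}) (I : set R) (n : nat)
    (x0 : 'I_n -> R) (X : 'I_n -> R -> R) : Prop :=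
  [/\ forall i, X i 0 = x0 i,
      forall i, {within `[0, +oo[, continuous (X i)},
      forall (t : R) i, 0 <= t -> I (X i t),
      forall (t : R) i k, 0 <= t -> k != i -> X k t != X i t &
      forall (t : R) i, 0 < t ->
        is_derive t 1 (X i)
          (- p.[X i t] * (\sum_(k < n | k != i) 2 / (X k t - X i t))
           + p^`().[X i t] - q.[X i t])].

(* Main.v *)
Require Import Defs.
From mathcomp Require Import measurable_realfun ring lra.
Import Order.TTheory GRing.Theory Num.Theory.
Import numFieldNormedType.Exports.
Local Open Scope classical_set_scope.
Local Open Scope ring_scope.

(* If U(t, .) is the monic polynomial with roots x_i(t), the system says that
   U_t = -(p U')' + q U' - lambda_n U at these roots.  So expand
   U(0, .) = sum_k c_k y_k over k <= n and put
   U(t, .) = sum_k c_k exp((lambda_k - lambda_n) t) y_k, which converges to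
   c_n y_n at rate exp(-(lambda_n - lambda_(n-1)) t); simple roots follow at
   the same rate.  What must be shown is that U(t, .) keeps n distinct roots
   in I.  The system is the gradient flow, for the metric p^-1, of the
   logarithmic energy, so prod_(i != k) (x_k - x_i)^2 prod_i (p w)(x_i)^2 does
   not decrease.  As p w tends to 0 at the finite endpoints of I, this excludes
   both collisions and exits.  That limit comes from self-adjointness: y_j is
   orthogonal to y_0 for j >= 1, so that each of p w y_1' and p w y_2' has equal
   limits at the two ends of I; as y_2'/y_1' is affine, those limits are 0. *)

(** * Boundary behaviour of p w *)

(** Dominated convergence with |g| as the bound: at each point the restrictions of g to the sets
    [A n] are eventually constant. It yields the limits of a primitive at plus and minus
    infinity. *)
Lemma cvg_Rintegral_eventually (R : realType) (g : R -> R) (A : nat -> set R)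
    (D : set R) :
  (forall n, measurable (A n)) -> measurable D ->
  (@lebesgue_measure R).-integrable setT (EFin \o g) ->
  (forall x, \forall n \near \oo, A n x <-> D x) ->
  (\int[@lebesgue_measure R]_(x in A n) g x) @[n --> \oo] -->
  \int[@lebesgue_measure R]_(x in D) g x.
Proof.
move=> mA mD ig AD.
have igr B : measurable B ->
    (@lebesgue_measure R).-integrable setT (EFin \o (g \_ B)).
  move=> mB; rewrite -restrict_EFin; apply/integrable_restrict => //=.
  by rewrite setTI; exact: integrableS ig.
rewrite [X in _ --> X]Rintegral_mkcond.
under eq_fun do rewrite Rintegral_mkcond.
apply: fine_cvg.
rewrite fineK; last by apply: integrable_fin_num => //; exact: igr.
have [|||||_ _ h] := @dominated_convergence _ _ R (@lebesgue_measure R) setT measurableT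
  (fun n => EFin \o (g \_ (A n))) (EFin \o (g \_ D)) (abse \o (EFin \o g)).
- by move=> n; exact: measurable_int (igr _ _).
- exact: measurable_int (igr _ _).
- apply: aeW => x _; apply: cvg_near_cst.
  near=> n; rewrite /= !patchE.
  have [h1 h2] : A n x <-> D x by near: n; exact: AD.
  have -> // : (x \in A n) = (x \in D).
  by apply/idP/idP; rewrite !inE.
- exact: integrable_abse.
- apply: aeW => x n _; rewrite /= patchE; case: ifP => // _.
  by rewrite normr0 lee_fin.
exact: h.
Unshelve. all: by end_near. Qed.

Lemma open_interval_measurable (R : realType) (I : set R) :
  open_interval I -> measurable I.
Proof. by move=> [oI _ _]; exact: open_measurable. Qed.

(* K is C plus the integral of f over I up to x. *)
Lemma primitive_extension (R : realType) (I : set R) (F f : R -> R) :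
  open_interval I ->
  (forall x, I x -> is_derive x 1 F (f x)) ->
  (forall x, I x -> {for x, continuous f}) ->
  (@lebesgue_measure R).-integrable I (EFin \o f) ->
  \int[@lebesgue_measure R]_(x in I) f x = 0 ->
  exists (K : R -> R) (C : R),
    [/\ continuous K, forall x, I x -> K x = F x,
        forall x, ~ I x -> K x = C,
        exists B, forall x, `|K x| <= B &
        K n%:R @[n --> \oo] --> C /\ K (- n%:R) @[n --> \oo] --> C].
Proof.
move=> hI dF cf intf f0.
have mI := open_interval_measurable _ _ hI.
case: hI => [oI itvI [c Ic]].
(* Extending f by zero reduces everything to one primitive [H] on the whole line. *)
pose g := f \_ I.
have ig : (@lebesgue_measure R).-integrable setT (EFin \o g).
  by rewrite -restrict_EFin; apply/integrable_restrict => //=; rewrite setTI.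
have igS A : measurable A -> (@lebesgue_measure R).-integrable A (EFin \o g).
  by move=> mA; apply: integrableS ig.
pose H x := \int[@lebesgue_measure R]_(t in `]-oo, x]) g t.
have HB x y : x <= y -> H y - H x = \int[@lebesgue_measure R]_(t in `]x, y]) g t.
  by move=> xy; apply: Rintegral_itvB => //; exact: igS.
have HI x y : I x -> I y -> x <= y -> H y - H x = F y - F x.
  move=> Ix Iy; rewrite le_eqVlt => /predU1P[->|xy]; first by rewrite !subrr.
  have sub z : z \in `[x, y] -> I z.
    by rewrite in_itv /= => /andP[xz zy]; apply: (itvI x y) => //; rewrite xz zy.
  have subo z : z \in `]x, y[ -> I z.
    by move=> zxy; apply: sub; move: z zxy; apply: subset_itvW.
  rewrite HB ?ltW// Rintegral_itv_obnd_cbnd; last exact: igS.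
  have -> : \int[@lebesgue_measure R]_(t in `[x, y]) g t =
     \int[@lebesgue_measure R]_(t in `[x, y]) f t.
    apply: eq_Rintegral => z; rewrite inE /= => zxy.
    by rewrite /g patchE mem_set//; exact: sub.
  rewrite /Rintegral (@continuous_FTC2 _ f F)//.
  - apply: continuous_in_subspaceT => z; rewrite inE => /sub /cf; exact.
  - have cF z : I z -> {for z, continuous F}.
      move=> /dF [dFz _]; apply/differentiable_continuous.
      exact/derivable1_diffP.
    split.
    + by move=> z /subo /dF [].
    + by apply: cvg_at_right_filter; exact: cF.
    + by apply: cvg_at_left_filter; exact: cF.
  - by move=> z /subo /dF [? <-]; rewrite derive1E.
(* The constant makes K agree with F at the base point c, hence on all of I. Continuity of K is the
   absolute continuity of the integral. *)
exists (fun x => F c - H c + H x), (F c - H c); split.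
- move=> x; apply: cvgD; first exact: cvg_cst.
  apply/cvgrPdist_lt => e e0.
  have [d [d0 hd]] := integral_normr_continuous ig e0.
  have key a b : a <= b -> b - a < d -> `|H b - H a| < e.
    move=> ab abd; rewrite HB//.
    have muab : (@lebesgue_measure R `]a, b]%classic < d%:E)%E.
      rewrite lebesgue_measure_itv/= lte_fin.
      by case: ifP => _; rewrite ?lte_fin // -EFinD lte_fin.
    apply: le_lt_trans (hd _ (measurable_itv _) muab).
    by apply: le_normr_Rintegral => //; exact: igS.
  exists d => // z; rewrite /ball_ /= => xz.
  have [xlez|/ltW zlex] := leP x z.
    rewrite distrC; apply: key => //.
    by move: xz; rewrite distrC ger0_norm ?subr_ge0.
  by apply: key => //; move: xz; rewrite ger0_norm ?subr_ge0.
- move=> x Ix; have [cx|/ltW xc] := leP c x.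
    by have := HI _ _ Ic Ix cx; lra.
  by have := HI _ _ Ix Ic xc; lra.
(* To the right of I, [H] is the full integral, which is 0 by hypothesis; to the left nothing has
   been integrated yet. So K takes the same value C on both sides. *)
- move=> x nIx; suff -> : H x = 0 by rewrite addr0.
  rewrite /H.
  have [cx|xc] := ltP c x.
    rewrite -[RHS]f0 [RHS]Rintegral_mkcond [LHS]Rintegral_mkcond -/g.
    congr (\int[_]_(z in _) _); apply/funext => z; rewrite patchE.
    case: ifPn => //; rewrite notin_setE /= in_itv /= => /negP; rewrite -ltNge => xz.
    rewrite /g patchE; case: ifPn => //; rewrite inE => Iz.
    by exfalso; apply: nIx; apply: (itvI c z) => //; rewrite !ltW.
  rewrite -[RHS](@Rintegral_set0 _ _ _ (@lebesgue_measure R) g).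
  rewrite [RHS]Rintegral_mkcond [LHS]Rintegral_mkcond.
  congr (\int[_]_(z in _) _); apply/funext => z; rewrite /g !patchE.
  rewrite [RHS]ifF; last by apply/negbTE; rewrite notin_setE.
  case: ifPn => //; rewrite inE /= in_itv /= => zx; case: ifPn => //.
  by rewrite inE => Iz; exfalso; apply: nIx; apply: (itvI z c) => //; rewrite zx xc.
- exists (`|F c - H c| + \int[@lebesgue_measure R]_t `|g t|) => x.
  rewrite (le_trans (ler_normD _ _))// lerD2l /H.
  apply: le_trans (le_normr_Rintegral _ (igS _ _)) _ => //.
  rewrite Rintegral_mkcond; apply: le_Rintegral => //.
  + rewrite -restrict_EFin; apply/integrable_restrict => //=; rewrite setTI.
    by have := integrable_norm (igS _ (measurable_itv `]-oo, x])).
  + by have := integrable_norm ig.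
  + by move=> z _; rewrite patchE; case: ifP => _; [exact: lexx|exact: normr_ge0].
- have hT : \int[@lebesgue_measure R]_(x in setT) g x = 0 by rewrite -Rintegral_mkcond.
  split; rewrite -[X in _ --> X]addr0; apply: cvgD; try exact: cvg_cst.
  + rewrite -hT.
    apply: cvg_Rintegral_eventually => // x; near=> n; split => //= _.
    by rewrite in_itv /=; near: n; exact: nbhs_infty_ger.
  + rewrite -[X in _ --> X](@Rintegral_set0 _ _ _ (@lebesgue_measure R) g).
    apply: cvg_Rintegral_eventually => // x; near=> n; split => //=.
    rewrite in_itv /= => xn.
    suff : - x < n%:R by move: xn; lra.
    by near: n; exact: nbhs_infty_gtr.
Unshelve. all: by end_near. Qed.

(** If C were nonzero, |K (u n)| would stay above |C| / 2 while the affine factor is unbounded,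
    contradicting the bound on the product. *)
Lemma cvg_affine_mul_bounded_eq0 (R : realType) (K : R -> R) (u : nat -> R) (C m s B : R) :
  s != 0 -> K (u n) @[n --> \oo] --> C ->
  (\forall n \near \oo, n%:R <= `|u n| /\ `|(m + s * u n) * K (u n)| <= B) ->
  C = 0.
Proof.
move=> s0 KC uB; apply/eqP; apply: contraPT isT => C0.
have C0' : 0 < `|C| by rewrite normr_gt0.
have s0' : 0 < `|s| by rewrite normr_gt0.
have hn : \forall n \near \oo, `|C| / 2 < `|K (u n)|.
  by apply: cvgr_norm_gt KC _ _; lra.
near \oo => n.
have [n1 n2] : n%:R <= `|u n| /\ `|(m + s * u n) * K (u n)| <= B by near: n.
have n3 : `|C| / 2 < `|K (u n)| by near: n.
(* Beyond this threshold the affine factor exceeds 2 |B| / |C|, so the product exceeds |B|. *)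
have n4 : (`|B| * 2 / `|C| + `|m|) / `|s| < n%:R by near: n; exact: nbhs_infty_gtr.
have h : `|B| * 2 / `|C| < `|m + s * u n|.
  have : `|s| * `|u n| <= `|m + s * u n| + `|m|.
    have := ler_normB (m + s * u n) m.
    by rewrite [m + _]addrC addrK normrM.
  move: n4; rewrite ltr_pdivrMr// => n4 h.
  have : n%:R * `|s| <= `|s| * `|u n| by rewrite mulrC ler_wpM2l// ltW.
  lra.
have : `|B| < `|(m + s * u n) * K (u n)|.
  rewrite normrM.
  have -> : `|B| = (`|B| * 2 / `|C|) * (`|C| / 2) by field; rewrite gt_eqF.
  by apply: ltr_pM => //; rewrite ?divr_ge0// mulr_ge0.
by move=> /lt_le_trans/(_ n2); rewrite ltNge ler_norm.
Unshelve. all: by end_near. Qed.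

Lemma closure_inf (R : realType) (A : set R) :
  A !=set0 -> has_lbound A -> closure A (inf A).
Proof.
move=> A0 Al B [e /= e0 eB].
have [z Az ze] := inf_adherent e0 (conj A0 Al).
exists z; split => //; apply: eB; rewrite /ball_ /=.
have : inf A <= z by exact: ge_inf.
by move=> iz; rewrite ler0_norm; lra.
Qed.

Lemma open_interval_boundary (R : realType) (I : set R) :
  open_interval I ->
  (has_ubound I -> ~ I (sup I)) /\ (has_lbound I -> ~ I (inf I)).
Proof.
move=> [oI _ _]; split=> hb Ib.
- have /= [e /= e0 eI] := open_nbhs_nbhs (conj oI Ib).
  have /(ub_le_sup hb) : I (sup I + e / 2).
    by apply: eI; rewrite /ball_ /= opprD addrA subrr sub0r normrN gtr0_norm; lra.
  lra.
- have /= [e /= e0 eI] := open_nbhs_nbhs (conj oI Ib).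
  have /(ge_inf hb) : I (inf I - e / 2).
    by apply: eI; rewrite /ball_ /= opprB addrC subrK gtr0_norm; lra.
  lra.
Qed.

(* At a point b of the boundary, D = (m + s b) C, so two boundary points force
   C = 0; on an unbounded interval K = L / (m + s x) tends to 0 as L is bounded. *)
Lemma boundary_value_eq0 (R : realType) (I : set R) (K L : R -> R) (C D m s e : R) :
  open_interval I -> continuous K -> continuous L ->
  (forall x, ~ I x -> K x = C) -> (forall x, ~ I x -> L x = D) ->
  (exists B, forall x, `|L x| <= B) ->
  K n%:R @[n --> \oo] --> C -> K (- n%:R) @[n --> \oo] --> C ->
  s != 0 -> (forall x, I x -> L x = (m + s * x) * K x) -> ~ I e ->
  C = 0.
Proof.
move=> hI cK cL KC LD [B LB] Ky KNy s0 LK nIe.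
have [Isup Iinf] := open_interval_boundary _ _ hI.
case: hI => [oI itvI [c Ic]].
have I0 : I !=set0 by exists c.
(* The relation between L and K is a closed condition, so it passes from I to its closure. *)
have bd b : closure I b -> ~ I b -> D = (m + s * b) * C.
  move=> clb nIb; rewrite -(LD _ nIb) -(KC _ nIb).
  apply/eqP; rewrite -subr_eq0; apply/eqP.
  have : closed [set x | L x - (m + s * x) * K x = 0].
    apply: closed_comp (@closed_eq R 0) => x _.
    apply: cvgB; [exact: cL | apply: cvgM; last exact: cK].
    by apply: cvgD; [exact: cvg_cst|apply: cvgMr; exact: cvg_id].
  rewrite closure_id => clE.
  have := @closureS _ I [set x | L x - (m + s * x) * K x = 0] _ _ clb.
  rewrite -clE; apply => x Ix /=.
  by rewrite LK // subrr.
have [hub|nub] := pselect (has_ubound I); last first.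
  apply: (@cvg_affine_mul_bounded_eq0 _ K (fun n => n%:R) C m s B) => //.
  near=> n; split; first by rewrite ger0_norm.
  rewrite -LK //.
  have cn : c <= n%:R by near: n; exact: nbhs_infty_ger.
  apply: contrapT => nIn; apply: nub; exists n%:R => z Iz.
  rewrite leNgt; apply/negP => nz; apply: nIn; apply: (itvI c z) => //.
  by rewrite cn ltW.
have [hlb|nlb] := pselect (has_lbound I); last first.
  apply: (@cvg_affine_mul_bounded_eq0 _ K (fun n => - n%:R) C m s B) => //.
  near=> n; split; first by rewrite normrN ger0_norm.
  rewrite -LK //.
  have cn : - c <= n%:R by near: n; exact: nbhs_infty_ger.
  apply: contrapT => nIn; apply: nlb; exists (- n%:R) => z Iz.
  rewrite leNgt; apply/negP => nz; apply: nIn; apply: (itvI z c) => //.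
  by rewrite ltW //= lerNl.
have e1 := bd _ (closure_sup I0 hub) (Isup hub).
have e2 := bd _ (closure_inf _ _ I0 hlb) (Iinf hlb).
have lt : inf I < sup I.
  have a1 : inf I < c.
    rewrite lt_neqAle (ge_inf hlb Ic) andbT; apply/eqP => E.
    by apply: (Iinf hlb); rewrite E.
  exact: lt_le_trans a1 (ub_le_sup hub Ic).
(* Subtracting the relations at the two endpoints eliminates D and m. *)
have : s * (sup I - inf I) * C = 0 by have := e1; rewrite {1}e2; lra.
move/eqP; rewrite !mulf_eq0 (negbTE s0) subr_eq0 (gt_eqF lt) /=.
by move/eqP.
Unshelve. all: by end_near. Qed.

(** * From the eigenvalue problem to the vanishing of p w at the boundary *)

Lemma lead_coef_graded (R : realType) (Y : nat -> {poly R}) :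
  (forall k, size (Y k) = k.+1) -> forall k, (Y k)`_k != 0.
Proof.
move=> sY k; have := lead_coef_eq0 (Y k).
by rewrite lead_coefE sY -size_poly_eq0 sY /= => ->.
Qed.

Lemma is_derive_sl_weight (R : realType) (p q : {poly R}) (I : set R) (w : R -> R) :
  (forall x, I x -> 0 < p.[x]) -> sl_weight p q I w ->
  forall x, I x -> is_derive x 1 w (- q.[x] / p.[x] * w x).
Proof.
move=> p0 hw x Ix; have [w0 dw w'] := hw x Ix.
apply: DeriveDef => //; rewrite -derive1E mulNr -w' mulrVK //.
by rewrite unitfE gt_eqF.
Qed.

(** Since I is open, f coincides with P near each point of I, so the analytic derivatives are those
    of the polynomial. *)
Lemma polynomial_eigen_equation (R : realType) (p q P : {poly R}) (I : set R)
    (mu : R) (f : R -> R) :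
  open I -> solves_on p q I mu f -> (forall x, I x -> f x = P.[x]) ->
  forall x, I x -> (- (p * P^`())^`() + q * P^`()).[x] = mu * P.[x].
Proof.
move=> oI hf fP.
have nearI x : I x -> \near x, I x by move=> Ix; exact: open_nbhs_nbhs.
have f'P x : I x -> derive1 f x = P^`().[x].
  move=> Ix; rewrite derive1E.
  apply: (@derive_val _ _ _ _ _ _ _ (near_eq_is_derive _ (is_derive_poly P x))).
  by near do rewrite fP //; exact: nearI.
move=> x Ix; have [_ _] := hf x Ix.
rewrite fP // f'P // => <-; rewrite hornerD hornerN hornerM; congr (- _ + _).
rewrite derive1E; apply/esym.
apply: (@derive_val _ _ _ _ _ _ _ (near_eq_is_derive _ (is_derive_poly _ x))).
by near do rewrite f'P ?hornerM//; exact: nearI.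
Unshelve. all: by end_near. Qed.

(** The equation w' = - (q / p) w makes w an integrating factor, turning the operator applied to P
    into a total derivative. *)
Lemma is_derive_weight (R : realType) (p q P : {poly R}) (I : set R) (w : R -> R) :
  (forall x, I x -> 0 < p.[x]) -> sl_weight p q I w ->
  forall x, I x ->
    is_derive x 1 (fun z => p.[z] * w z * P^`().[z])
      (- (- (p * P^`())^`() + q * P^`()).[x] * w x).
Proof.
move=> p0 hw x Ix; have dw := is_derive_sl_weight _ _ _ _ _ p0 hw _ Ix.
have dpw := is_deriveM (is_derive_poly p x) dw.
apply: is_derive_eq (is_deriveM dpw (is_derive_poly P^`() x)) _.
rewrite /GRing.scale /= derivM !hornerE /=.
rewrite -[(horner p * w) x]/(p.[x] * w x).
by field; rewrite gt_eqF // p0.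
Qed.

(** Since |f| <= f^2 + 1, the function f w is dominated by f^2 w + w. The constant c stands for the
    value of y_0, through which w itself is known to be integrable; hence the rescaling by c^-2. *)
Lemma integrable_sqr_weight (R : realType) (I : set R) (w f : R -> R) (c : R) :
  measurable I -> c != 0 -> measurable_fun I w -> (forall x, I x -> 0 < w x) ->
  L2 I w f -> L2 I w (fun=> c) ->
  (@lebesgue_measure R).-integrable I (fun x => (f x * w x)%:E).
Proof.
move=> mI c0 mw w0 [mf if2] [_ ic2].
have c20 : c ^+ 2 != 0 by rewrite expf_neq0.
have ig : (@lebesgue_measure R).-integrable I
    (fun x => ((f x ^+ 2 * w x)%:E + ((c ^+ 2)^-1)%:E * (c ^+ 2 * w x)%:E)%E).
  by apply: integrableD => //; exact: integrableZl.
apply: le_integrable ig => //.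
  by apply/measurable_EFinP; exact: measurable_funM.
move=> x Ix; have wx := w0 x Ix.
rewrite /= lee_fin mulrA mulVf // mul1r.
rewrite normrM (gtr0_norm wx).
apply: le_trans (ler_norm _).
rewrite -{3}[w x]mul1r -mulrDl ler_wpM2r ?(ltW wx)//.
rewrite -[f x ^+ 2]ger0_norm ?sqr_ge0// normrX.
have := sqr_ge0 (`|f x| - 1); have := normr_ge0 (f x); nra.
Qed.

(** W is the extension of p w y_1' divided by the constant y_1'. It is continuous on the whole line
    and zero off I, so the boundary needs no separate treatment when the energy is used later. *)
Lemma weight_extension (R : realType) (p q : {poly R}) (I : set R)
    (lambda : nat -> R) (y : nat -> R -> R) :
  open_interval I -> sturm_liouville p q I lambda y ->
  (forall j, polynomial_of_degree_on I j (y j)) ->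
  exists (w W : R -> R),
    [/\ sl_weight p q I w, continuous W,
        forall x, I x -> W x = p.[x] * w x & forall x, ~ I x -> W x = 0].
Proof.
move=> hI [p0 lam0 lamS sol [w [A [hw _ [_ sa] _ eig]]]] hpoly.
have [Y hY] := choice hpoly.
have sY j : size (Y j) = j.+1 by have [] := hY j.
have yY j x : I x -> y j x = (Y j).[x] by have [_] := hY j; apply.
have mI := open_interval_measurable _ _ hI.
have [oI itvI [c Ic]] := hI.
have wpos x : I x -> 0 < w x by move=> /hw [].
have cw : {in I, continuous w}.
  move=> x; rewrite inE => /hw [_ dw _].
  by apply/differentiable_continuous; exact/derivable1_diffP.
have mw : measurable_fun I w by exact: open_continuous_measurable_fun.
have Ay j : A (y j) (fun x => lambda j * y j x) by have [] := eig j.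
have L2y j : L2 I w (y j) by have [] := (sa _ _).1 (Ay j).
have Y0 x : (Y 0%N).[x] = (Y 0%N)`_0.
  by rewrite (@horner_coef_wide _ 1) ?sY// big_ord1 expr0 mulr1.
have lcY := lead_coef_graded _ _ sY.
have c0 : (Y 0%N)`_0 != 0.
  exact: (lcY 0%N).
have iY j : (@lebesgue_measure R).-integrable I (fun x => ((Y j).[x] * w x)%:E).
  have L2c : L2 I w (fun=> (Y 0%N)`_0).
    have [_ i0] := L2y 0%N; split; first exact: measurable_cst.
    apply: eq_integrable i0 => // x; rewrite inE => Ix.
    by rewrite yY // Y0.
  apply: eq_integrable (integrable_sqr_weight _ _ _ _ _ mI c0 mw wpos (L2y j) L2c) => //.
  by move=> x; rewrite inE => Ix; rewrite yY.
have Y_0 j : (0 < j)%N -> \int[@lebesgue_measure R]_(x in I) ((Y j).[x] * w x) = 0.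
  (* <L y_j, y_0> = <y_j, L y_0> = 0, and y_0 is a nonzero constant. *)
  move=> j0; have [_ _ /(_ _ _ (Ay 0%N))] := (sa _ _).1 (Ay j).
  have lamj : lambda j != 0.
    rewrite gt_eqF // -lam0; elim: j j0 => // -[|j] IH _; first exact: lamS.
    exact: lt_trans (IH _) (lamS _).
  have -> : L2_dot I w (y j) (fun x => lambda 0%N * y 0%N x) = 0.
    rewrite /L2_dot lam0; under eq_Rintegral do rewrite mul0r mulr0 mul0r.
    by rewrite /Rintegral integral0.
  have -> : L2_dot I w (fun x => lambda j * y j x) (y 0%N) =
     (lambda j * (Y 0%N)`_0) * \int[@lebesgue_measure R]_(x in I) ((Y j).[x] * w x).
    rewrite /L2_dot -RintegralZl //; last exact: iY.
    congr fine; apply: eq_integral => x; rewrite inE => Ix.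
    by rewrite !yY // Y0; congr (_%:E); ring.
  by move/eqP; rewrite !mulf_eq0 (negbTE lamj) (negbTE c0) => /eqP.
(* By the eigenvalue equation p w y_j' is a primitive of - lambda_j w y_j, whose integral over I
   vanishes for j >= 1. *)
have prim j := @primitive_extension _ I (fun z => p.[z] * w z * (Y j)^`().[z])
   (fun x => - lambda j * ((Y j).[x] * w x)) hI.
have ext j : (0 < j)%N -> exists (K : R -> R) (C : R),
    [/\ continuous K, forall x, I x -> K x = p.[x] * w x * (Y j)^`().[x],
        forall x, ~ I x -> K x = C,
        exists B, forall x, `|K x| <= B &
        K n%:R @[n --> \oo] --> C /\ K (- n%:R) @[n --> \oo] --> C].
  move=> j0; apply: prim.
  - move=> x Ix.
    apply: is_derive_eq (is_derive_weight _ _ _ (Y j) _ _ p0 hw _ Ix) _.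
    rewrite (polynomial_eigen_equation _ _ _ _ _ _ _ oI (sol j) (yY j)) //.
    by rewrite -mulNr mulrA.
  - move=> x Ix; apply: cvgMr; apply: cvgM; first exact: continuous_horner.
    by apply: cw; rewrite inE.
  - have h : (@lebesgue_measure R).-integrable I
        (fun x => ((- lambda j)%:E * ((Y j).[x] * w x)%:E)%E).
      by apply: integrableZl => //; exact: iY.
    exact: h.
  - by rewrite RintegralZl ?Y_0 ?mulr0 //; exact: iY.
have [K1 [C1 [cK1 K1I K1C _ [K1y K1Ny]]]] := ext 1%N isT.
have [K2 [C2 [cK2 K2I K2C K2B _]]] := ext 2%N isT.
have Yd j x : (Y j)^`().[x] = \sum_(i < j) ((Y j)`_i.+1 *+ i.+1) * x ^+ i.
  rewrite (@horner_coef_wide _ j).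
    by apply: eq_bigr => i _; rewrite coef_deriv.
  by rewrite -ltnS -(sY j); apply: lt_size_deriv; rewrite -size_poly_eq0 sY.
set l := (Y 1%N)`_1.
have l0 : l != 0 by exact: lcY.
have Y1 x : (Y 1%N)^`().[x] = l by rewrite Yd big_ord1 mulr1n mulr1.
exists w, (fun x => K1 x / l); split => //.
- by move=> x; apply: cvgM; [exact: cK1|exact: cvg_cst].
- by move=> x Ix; rewrite K1I // Y1 mulfK.
- move=> x nIx; rewrite K1C //.
  (* On I, [K1] is l p w, so [l * K2] equals [K1] times y_2', an affine function whose slope is
     twice the leading coefficient of y_2. *)
  rewrite (@boundary_value_eq0 R I K1 (fun x => l * K2 x) C1 (l * C2)
     ((Y 2%N)`_1) ((Y 2%N)`_2 *+ 2) x) ?mul0r //.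
  + by move=> z; apply: cvgMr; exact: cK2.
  + by move=> z nIz; rewrite K2C.
  + have [B hB] := K2B; exists (`|l| * B) => z.
    by rewrite normrM ler_wpM2l.
  + by rewrite mulrn_eq0 /= lcY.
  + move=> z Iz; rewrite K2I // K1I // Y1 Yd !big_ord_recl big_ord0 /=.
    rewrite /bump /= expr0 expr1 mulr1n addn0; ring.
Qed.

(** * Polynomials with distinct real roots *)

(** When A has degree n, these are all its roots, and the ordering fixes their labels. This is what
    makes the moving roots single-valued functions of time. *)
Definition increasing_roots {R : realType} {n : nat} (A : {poly R}) (r : 'I_n -> R) : Prop :=
  (forall i k : 'I_n, (i < k)%N -> r i < r k) /\ forall i, root A (r i).

Lemma increasing_neq (R : realType) (n : nat) (r : 'I_n -> R) :
  (forall i k : 'I_n, (i < k)%N -> r i < r k) ->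
  forall i k, k != i -> r k != r i.
Proof.
move=> hr i k ki; case: (ltngtP k i) => [/hr /lt_eqF -> //|/hr /gt_eqF -> //|/val_inj ki'].
by rewrite ki' eqxx in ki.
Qed.

Lemma increasing_gap (R : realType) (n : nat) (r : 'I_n -> R) :
  (forall i k : 'I_n, (i < k)%N -> r i < r k) ->
  exists2 d : R, 0 < d & forall i k, k != i -> d <= `|r k - r i|.
Proof.
(* The default 1 serves when there is no pair, that is for n <= 1. *)
move=> hr; exists (\big[Num.min/1]_(ik : 'I_n * 'I_n | ik.2 != ik.1) `|r ik.2 - r ik.1|).
  by apply: lt_bigmin => // -[i k] /= ki; rewrite normr_gt0 subr_eq0 increasing_neq.
by move=> i k ki; apply: (@bigmin_le_cond _ _ _ 1 (i, k) _
  (fun ik : 'I_n * 'I_n => `|r ik.2 - r ik.1|)).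
Qed.

Lemma monic_roots_prod (R : realType) (n : nat) (A : {poly R}) (r : 'I_n -> R) :
  size A = n.+1 -> A \is monic -> increasing_roots A r ->
  A = \prod_(i < n) ('X - (r i)%:P).
Proof.
move=> sA mA [ri rA].
rewrite (@all_roots_prod_XsubC _ A [seq r i | i <- enum 'I_n]).
- by rewrite (monicP mA) scale1r big_map big_enum.
- by rewrite size_map -cardE card_ord.
- by apply/allP => _ /mapP[i _ ->].
- rewrite uniq_rootsE map_inj_uniq ?enum_uniq// => i k; apply: contra_eq.
  by move=> ik; apply: increasing_neq.
Qed.

(* s i = r (f i) with f strictly increasing, hence i <= f i. *)
Lemma le_increasing_roots (R : realType) (n : nat) (A : {poly R}) (r s : 'I_n -> R) :
  size A = n.+1 -> A \is monic -> increasing_roots A r -> increasing_roots A s ->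
  forall i, r i <= s i.
Proof.
move=> sA mA hr [si sR]; have [ri _] := hr.
have /fin_all_exists [f hf] : forall i, exists k, s i = r k.
  move=> i; have := sR i; rewrite (monic_roots_prod _ _ _ _ sA mA hr) /root.
  rewrite horner_prod prodf_seq_eq0 => /hasP[k _ /=].
  by rewrite !hornerE subr_eq0 => /eqP e; exists k.
have fi (i k : 'I_n) : (i < k)%N -> (f i < f k)%N.
  move=> /si; rewrite !hf => h; case: (ltngtP (f i) (f k)) => // [/ri|/val_inj e].
    by move=> /(lt_trans h); rewrite ltxx.
  by move: h; rewrite e ltxx.
have lef m (hm : (m < n)%N) : (m <= f (Ordinal hm))%N.
  elim: m hm => // m IH hm.
  exact: leq_ltn_trans (IH (ltnW hm)) (fi (Ordinal (ltnW hm)) (Ordinal hm) (ltnSn _)).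
move=> [i hi]; rewrite hf; have := lef i hi.
rewrite leq_eqVlt => /orP[/eqP e|h]; last exact/ltW/ri.
by rewrite (_ : f _ = Ordinal hi) //; apply: val_inj.
Qed.

Lemma increasing_roots_unique (R : realType) (n : nat) (A : {poly R}) (r s : 'I_n -> R) :
  size A = n.+1 -> A \is monic -> increasing_roots A r -> increasing_roots A s ->
  r = s.
Proof.
move=> sA mA hr hs; apply/funext => i; apply/eqP; rewrite eq_le.
by rewrite !(le_increasing_roots _ _ A).
Qed.

Lemma poly_sign_change_root (R : realType) (A : {poly R}) (a b : R) :
  a <= b -> A.[a] * A.[b] < 0 -> exists2 c, a <= c <= b & root A c.
Proof.
move=> ab h.
have [A0|A0] := ltP A.[a] 0.
  apply: poly_ivt ab _; rewrite (ltW A0) /=.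
  by move: h; rewrite nmulr_rlt0 // => /ltW.
have Aa : 0 < A.[a].
  by rewrite lt_neqAle A0 andbT; apply/eqP => e; move: h; rewrite -e mul0r ltxx.
have [|c ? ?] := @poly_ivt R (- A) a b ab; last by exists c => //; rewrite -rootN.
by rewrite !hornerN oppr_le0 A0 oppr_ge0 /=; move: h; rewrite pmulr_rlt0 // => /ltW.
Qed.

(** A changes sign across each simple root, and pointwise convergence at finitely many points
    preserves these sign changes. The filter is left general: it is used both near a finite time and
    at infinity. *)
Lemma increasing_roots_perturb (R : realType) (n : nat) (A : {poly R})
    (T : Type) (F : set_system T) (FF : Filter F) (U : T -> {poly R})
    (r : 'I_n -> R) (e : R) :
  size A = n.+1 -> A \is monic -> increasing_roots A r ->
  (forall z, (U t).[z] @[t --> F] --> A.[z]) -> 0 < e ->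
  \forall t \near F, exists2 s : 'I_n -> R,
    increasing_roots (U t) s & forall i, `|s i - r i| < e.
Proof.
move=> sA mA hr cU e0.
have AE := monic_roots_prod _ _ _ _ sA mA hr.
have [ri _] := hr.
have [d d0 hd] := increasing_gap _ _ _ ri.
(* The bound e / 2 gives strict closeness; d / 3 keeps the intervals around distinct roots
   disjoint. *)
pose a := Num.min (e / 2) (d / 3).
have a0 : 0 < a by rewrite lt_min; apply/andP; split; lra.
have ae : a <= e / 2 by rewrite ge_min lexx.
have ad : a <= d / 3 by rewrite ge_min lexx orbT.
have neg i : A.[r i - a] * A.[r i + a] < 0.
  (* The i-th factor of the product is - a^2; every other one is (r_k - r_i)^2 - a^2 > 0. *)
  rewrite AE !horner_prod -big_split /= (bigD1 i) //= !hornerE.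
  rewrite nmulr_rlt0; last by nra.
  apply: prodr_gt0 => k ki; rewrite !hornerE.
  have := hd _ _ ki => h.
  have : a ^+ 2 < (r k - r i) ^+ 2.
    rewrite -[ltRHS]real_normK ?num_real//.
    by rewrite ltr_pXn2r ?nnegrE//; lra.
  by nra.
have : \forall t \near F, forall i, (U t).[r i - a] * (U t).[r i + a] < 0.
  apply: filter_forall => i.
  have : (U t).[r i - a] * (U t).[r i + a] @[t --> F] --> A.[r i - a] * A.[r i + a].
    by apply: cvgM; exact: cU.
  by move/cvgr_lt; apply.
apply: filterS => t ht.
have /fin_all_exists [s hs] : forall i, exists c, r i - a <= c <= r i + a /\ root (U t) c.
  move=> i; have ab : r i - a <= r i + a by lra.
  by have [c ? ?] := poly_sign_change_root _ _ _ _ ab (ht i); exists c.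
exists s; last first.
  by move=> i; have [/andP[h1 h2] _] := hs i; rewrite ltr_norml; apply/andP; split; lra.
split; last by move=> i; have [] := hs i.
move=> i k ik.
have [/andP[h1 h2] _] := hs i; have [/andP[h3 h4] _] := hs k.
have /hd : k != i by apply: contraTneq ik => ->; rewrite ltnn.
have := ri _ _ ik => rik; rewrite ger0_norm; lra.
Qed.

(** With A = (X - r_i) Q one has A' = Q and A'' = 2 Q' at r_i, and Q' / Q is a sum of simple
    fractions. This identifies the interaction sum of the system with - A'' / A'. *)
Lemma deriv2_prod_XsubC_root (R : realType) (n : nat) (r : 'I_n -> R) (i : 'I_n) :
  (forall k, k != i -> r k != r i) ->
  let A := \prod_(k < n) ('X - (r k)%:P) in
  A^`().[r i] != 0 /\
  A^`()^`().[r i] = - A^`().[r i] * \sum_(k < n | k != i) 2 / (r k - r i).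
Proof.
move=> hr A.
pose Q := \prod_(k < n | k != i) ('X - (r k)%:P).
have AE : A = ('X - (r i)%:P) * Q by rewrite /A (bigD1 i).
have A1 : A^`().[r i] = Q.[r i].
  by rewrite AE derivM derivXsubC mul1r !hornerE subrr mul0r addr0.
have A2 : A^`()^`().[r i] = 2 * Q^`().[r i].
  rewrite AE derivM derivXsubC mul1r derivD derivM derivXsubC mul1r.
  by rewrite !hornerD hornerM hornerXsubC subrr mul0r addr0 mulr_natl.
have Q0 : Q.[r i] != 0.
  rewrite horner_prod; apply/prodf_neq0 => k ki.
  by rewrite !hornerE subr_eq0 eq_sym hr.
rewrite A2 A1; split => //.
suff -> : Q^`().[r i] = - Q.[r i] * \sum_(k < n | k != i) (r k - r i)^-1.
  rewrite mulrCA; congr (_ * _); rewrite mulr_sumr //.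
(* The logarithmic derivative is proved by induction on the product, in a form with zero on one side
   that survives multiplication by a factor. *)
apply/eqP; rewrite -subr_eq0 mulNr opprK; apply/eqP; rewrite /Q.
elim/big_rec2: _ => [|k q S ki IH]; first by rewrite derivC horner0 mulr0 addr0.
rewrite derivM derivXsubC mul1r hornerD !hornerM hornerXsubC.
have e0 : r k - r i != 0 by rewrite subr_eq0 hr.
apply: (mulfI e0); rewrite mulr0.
rewrite (_ : _ * _ = (r k - r i) * (r i - r k) * (S^`().[r i] + S.[r i] * q)); last first.
  by field.
by rewrite IH mulr0.
Qed.

(** Implicit differentiation by hand: factoring out the root at time t expresses the difference
    quotient of g exactly through those of the coefficients, so continuity of g suffices to pass to
    the limit. *)
Lemma is_derive_root (R : realType) (m : nat) (a : 'I_m -> R -> R) (da : 'I_m -> R)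
    (Y : 'I_m -> {poly R}) (g : R -> R) (t : R) :
  (forall k, is_derive t 1 (a k) (da k)) ->
  {for t, continuous g} ->
  (\forall s \near t, root (\sum_k a k s *: Y k) (g s)) ->
  (\sum_k a k t *: Y k)^`().[g t] != 0 ->
  is_derive t 1 g (- (\sum_k da k * (Y k).[g t]) / (\sum_k a k t *: Y k)^`().[g t]).
Proof.
move=> ha cg rg.
have rt : root (\sum_k a k t *: Y k) (g t) by exact: nbhs_singleton rg.
have [Q EQ] := factor_theorem _ _ rt.
have -> : (\sum_k a k t *: Y k)^`().[g t] = Q.[g t].
  by rewrite EQ derivM derivXsubC mulr1 hornerD hornerM hornerXsubC subrr mulr0 add0r.
move=> Q0.
have sh : (h *: 1 + t : R) @[h --> (0 : R)^'] --> t.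
  rewrite -[X in _ --> X]add0r -[X in _ --> X + _](scale0r (1 : R)).
  apply: cvgD; last exact: cvg_cst.
  apply: cvgZ; last exact: cvg_cst.
  exact: nbhs_dnbhs.
have gh : g (h *: 1 + t) @[h --> (0 : R)^'] --> g t by exact: cvg_comp sh cg.
have dq : h^-1 *: ((g \o shift t) (h *: 1) - g t) @[h --> (0 : R)^'] -->
    - (\sum_k da k * (Y k).[g t]) / Q.[g t].
  have lim : - (\sum_k (h^-1 *: ((a k \o shift t) (h *: 1) - a k t)) *
       (Y k).[g (h *: 1 + t)]) / Q.[g (h *: 1 + t)] @[h --> (0 : R)^'] -->
       - (\sum_k da k * (Y k).[g t]) / Q.[g t].
    apply: cvgM; last first.
      by apply: cvgV => //; apply: cvg_comp gh _; exact: continuous_horner.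
    apply: cvgN; apply: cvg_big => [|k _]; first exact: add_continuous.
    apply: cvgM.
      by have [dk <-] := ha k; exact: dk.
    by apply: cvg_comp gh _; exact: continuous_horner.
  apply: cvg_trans lim; apply: near_eq_cvg; near=> h.
  have h0 : h != 0 by near: h; exact: nbhs_dnbhs_neq.
  have Qh : Q.[g (h *: 1 + t)] != 0.
    near: h; apply: (@cvgr_neq0 _ _ _ _ _ _ Q.[g t]) => //.
    by apply: cvg_comp gh _; exact: continuous_horner.
  have /rootP rh : root (\sum_k a k (h *: 1 + t) *: Y k) (g (h *: 1 + t)).
    by near: h; exact: sh rg.
  (* At g (t + h) the polynomial of time t + h vanishes, while that of time t is Q times the
     increment of g. *)
  have : (\sum_k (a k (h *: 1 + t) - a k t) * (Y k).[g (h *: 1 + t)])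
      = - (Q.[g (h *: 1 + t)] * (g (h *: 1 + t) - g t)).
    transitivity ((\sum_k a k (h *: 1 + t) *: Y k).[g (h *: 1 + t)] -
       (\sum_k a k t *: Y k).[g (h *: 1 + t)]).
      rewrite !horner_sum -sumrB; apply: eq_bigr => k _.
      by rewrite !hornerZ mulrBl.
    by rewrite rh EQ hornerM hornerXsubC sub0r.
  rewrite /= => e.
  under eq_bigr do rewrite -[_ *: _]/(_ * _) -mulrA.
  rewrite -mulr_sumr e -[_ *: (_ - _)]/(_ * _).
  by field; rewrite h0 Qh.
apply: DeriveDef; first by apply/cvg_ex; eexists; exact: dq.
exact: cvg_lim dq.
Unshelve. all: by end_near. Qed.

(** * The energy *)

(** The square makes the logarithm meaningful whatever the sign of f. *)
Lemma is_derive_ln_sqr (R : realType) (f : R -> R) (t df : R) :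
  f t != 0 -> is_derive t 1 f df ->
  is_derive t 1 (fun s => ln (f s ^+ 2)) (2 * df / f t).
Proof.
move=> ft hf.
have -> : (fun s => ln (f s ^+ 2)) = @ln R \o (f * f).
  by apply/funext => s; rewrite expr2.
have f2 : 0 < (f * f) t by rewrite -[(f * f) t]expr2 exprn_even_gt0.
apply: is_derive_eq (is_derive1_comp (is_derive1_ln f2) (is_deriveM hf hf)) _.
rewrite -[(f * f) t]/(f t * f t) -[_ *: _]/(_ * _); by field.
Qed.

Lemma is_derive_sum_cond (R : realType) (n : nat) (P : pred 'I_n)
    (h : 'I_n -> R -> R) (dh : 'I_n -> R) (t : R) :
  (forall i, P i -> is_derive t 1 (h i) (dh i)) ->
  is_derive t 1 (fun s => \sum_(i < n | P i) h i s) (\sum_(i < n | P i) dh i).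
Proof.
move=> hh.
rewrite (_ : (fun s => _) = \sum_(i < n | P i) h i); last first.
  by apply/funext => s; rewrite fct_sumE.
by elim/big_ind2 : _ => // [|] *; [exact: is_derive_cst|exact: is_deriveD].
Qed.

(* The left-hand side is the derivative of the logarithm of [energy_product]
   below, with P = p and b = p' - q. *)
Lemma sum_pairs_velocity (R : realType) (n : nat) (x v P b : 'I_n -> R) :
  (forall i, P i != 0) ->
  (forall i, v i = - P i * (\sum_(k < n | k != i) 2 / (x k - x i)) + b i) ->
  \sum_(i < n) \sum_(k < n | k != i) 2 * (v k - v i) / (x k - x i) +
  \sum_(i < n) 2 * (b i * v i / P i) = \sum_(i < n) 2 * v i ^+ 2 / P i.
Proof.
move=> P0 hv.
have -> : \sum_(i < n) \sum_(k < n | k != i) 2 * (v k - v i) / (x k - x i) =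
   \sum_(i < n) - 2 * v i * (\sum_(k < n | k != i) 2 / (x k - x i)).
  under eq_bigr do under eq_bigr do rewrite mulrBr mulrBl.
  under eq_bigr do rewrite sumrB.
  (* Exchanging i and k in the part with v_k turns it into a second copy of the part with v_i. *)
  rewrite sumrB (exchange_big_dep xpredT) //= -sumrB.
  apply: eq_bigr => i _.
  rewrite (eq_bigl (fun k => k != i)); last by move=> k; rewrite eq_sym.
  rewrite mulr_sumr -sumrB; apply: eq_bigr => k _.
  rewrite -(opprB (x k)) invrN; ring.
rewrite -big_split /=; apply: eq_bigr => i _.
set S := \sum_(k < n | k != i) 2 / (x k - x i).
have -> : - 2 * v i * S = 2 * v i * (- P i * S) / P i by field.
(* The velocity equation eliminates the interaction sum, and the terms with b cancel. *)
have -> : - P i * S = v i - b i by rewrite hv addrK.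
by field.
Qed.

(** The exponential of the logarithmic energy. Unlike the logarithm it stays finite and continuous
    at collisions and at points where W vanishes, taking the value 0 there. The sign conditions are
    absorbed by the squares. *)
Definition energy_product {R : realType} {n : nat} (W : R -> R) (x : 'I_n -> R) : R :=
  (\prod_(i < n) \prod_(k < n | k != i) (x k - x i) ^+ 2) * \prod_(i < n) W (x i) ^+ 2.

(** Because (p w)' / (p w) = (p' - q) / p, the logarithm of the product has derivative sum_i 2 v_i^2
    / p(x_i), which is nonnegative on I. *)
Lemma energy_product_nondecreasing (R : realType) (n : nat) (p q : {poly R}) (I : set R)
    (w W : R -> R) (X : 'I_n -> R -> R) (T t : R) :
  open I -> (forall x, I x -> 0 < p.[x]) -> sl_weight p q I w ->
  (forall x, I x -> W x = p.[x] * w x) ->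
  (forall s i, 0 <= s < T -> I (X i s)) ->
  (forall s i k, 0 <= s < T -> k != i -> X k s != X i s) ->
  (forall s i, 0 <= s < T -> is_derive s 1 (X i)
          (- p.[X i s] * (\sum_(k < n | k != i) 2 / (X k s - X i s))
           + p^`().[X i s] - q.[X i s])) ->
  0 <= t < T ->
  energy_product W (X^~ 0) <= energy_product W (X^~ t).
Proof.
move=> oI p0 hw WE XI Xd dX /andP[t0 tT].
(* The velocity is grouped into interaction and drift p' - q, as [sum_pairs_velocity] requires. *)
pose v i s := - p.[X i s] * (\sum_(k < n | k != i) 2 / (X k s - X i s))
           + (p^`().[X i s] - q.[X i s]).
have W0 x : I x -> W x != 0.
  by move=> Ix; rewrite WE // mulf_neq0 ?gt_eqF ?p0 //; have [] := hw x Ix.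
have dW x : I x -> is_derive x 1 W ((p^`().[x] - q.[x]) * w x).
  move=> Ix; have px := p0 x Ix.
  apply: (@near_eq_is_derive _ _ _ (fun z => p.[z] * w z)).
    by near=> z; rewrite WE //; near: z; exact: open_nbhs_nbhs.
  have dw := is_derive_sl_weight _ _ _ _ _ p0 hw _ Ix.
  apply: is_derive_eq (is_deriveM (is_derive_poly p x) dw) _.
  by rewrite -![_ *: _]/(_ * _); field; rewrite gt_eqF.
pose E s := \sum_(i < n) \sum_(k < n | k != i) ln ((X k s - X i s) ^+ 2) +
            \sum_(i < n) ln (W (X i s) ^+ 2).
have dE s : 0 <= s < T -> is_derive s 1 E (\sum_(i < n) 2 * v i s ^+ 2 / p.[X i s]).
  move=> hs.
  have dv i : is_derive s 1 (X i) (v i s).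
    by apply: is_derive_eq (dX s i hs) _; rewrite /v addrA.
  have pX i : p.[X i s] != 0 by rewrite gt_eqF // p0 //; exact: XI.
  rewrite -(sum_pairs_velocity _ _ (X^~ s) _ _ (fun i => p^`().[X i s] - q.[X i s])) //.
  apply: is_deriveD.
    apply: is_derive_sum_cond => i _; apply: is_derive_sum_cond => k ki.
    by apply: is_derive_ln_sqr; rewrite subr_eq0 Xd.
  apply: is_derive_sum_cond => i _.
  have h := is_derive1_comp (dW _ (XI s i hs)) (dv i).
  apply: is_derive_eq (is_derive_ln_sqr _ _ _ _ (W0 _ (XI s i hs)) h) _.
  rewrite /= WE; last exact: XI.
  field.
  by rewrite pX gt_eqF //; have [] := hw _ (XI s i hs).
have EP s : 0 <= s < T -> energy_product W (X^~ s) = expR (E s).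
  move=> hs; rewrite /E expRD !expR_sum; congr (_ * _).
    apply: eq_bigr => i _; rewrite expR_sum; apply: eq_bigr => k ki.
    by rewrite lnK // posrE exprn_even_gt0 //= subr_eq0 Xd.
  apply: eq_bigr => i _.
  by rewrite lnK // posrE exprn_even_gt0 //= W0 //; exact: XI.
rewrite !EP ?t0 ?tT ?lexx ?(le_lt_trans t0) // ler_expR.
have hs s : s \in `[0, t] -> 0 <= s < T.
  by rewrite in_itv /= => /andP[-> /le_lt_trans ->].
have oc s : s \in `]0, t[ -> s \in `[0, t] by apply: subset_itvW.
apply: (@ger0_derive1_le_cc _ E 0 t) => //; rewrite ?in_itv /= ?lexx ?t0 //.
- by move=> s /oc /hs /dE [].
- move=> s /oc /hs hs'; have [_ e] := dE s hs'; rewrite derive1E e.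
  apply: sumr_ge0 => i _; apply: mulr_ge0; first by rewrite mulr_ge0 // sqr_ge0.
  by rewrite invr_ge0 ltW // p0 //; exact: XI.
- by apply: derivable_within_continuous => s /hs /dE [].
Unshelve. all: by end_near. Qed.

(** * Expansions, root bounds and limits of root configurations *)

Lemma poly_graded_basis (R : realType) (Y : nat -> {poly R}) :
  (forall k, size (Y k) = k.+1) ->
  forall n (P : {poly R}), (size P <= n)%N ->
  exists c : nat -> R, P = \sum_(k < n) c k *: Y k.
Proof.
move=> sY; elim=> [|n IH] P sP.
  exists (fun=> 0); rewrite big_ord0; apply/eqP.
  by rewrite -size_poly_eq0 -leqn0.
pose b := P`_n / (Y n)`_n.
have Yn0 := lead_coef_graded _ _ sY n.
have /IH [c hc] : (size (P - b *: Y n)%R <= n)%N.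
  apply/leq_sizeP => j; rewrite leq_eqVlt => /orP[/eqP <-|nj].
    by rewrite coefB coefZ /b divfK // subrr.
  by rewrite coefB coefZ !nth_default ?sY ?mulr0 ?subr0 // (leq_trans sP).
exists (fun k => if k == n then b else c k).
rewrite big_ord_recr /= eqxx -[LHS](subrK (b *: Y n)) hc; congr (_ + _).
by apply: eq_bigr => k _; rewrite ltn_eqF.
Qed.

(** For |z| > 1 each lower term is at most B |z|^(n-1), to be compared with the leading term
    |z|^n. *)
Lemma monic_root_bound (R : realType) (n : nat) (A : {poly R}) (B z : R) :
  size A = n.+1 -> A \is monic -> (forall i, `|A`_i| <= B) -> root A z ->
  `|z| <= 1 + n%:R * B.
Proof.
move=> sA mA hB /rootP.
have B0 : 0 <= B by exact: le_trans (normr_ge0 _) (hB 0%N).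
have [z1 _|z1] := leP `|z| 1; first by rewrite (le_trans z1) // lerDl mulr_ge0.
rewrite horner_coef sA big_ord_recr /=.
have -> : A`_n = 1 by move/monicP: mA; rewrite lead_coefE sA.
rewrite mul1r; case: n sA => [|m] sA.
  by rewrite big_ord0 add0r expr0 => /eqP; rewrite oner_eq0.
move/eqP; rewrite addrC addr_eq0 => /eqP zE.
have : `|z| ^+ m.+1 <= (m.+1%:R * B) * `|z| ^+ m.
  rewrite -normrX zE normrN (le_trans (ler_norm_sum _ _ _)) //.
  rewrite -mulrA mulr_natl -[X in _ *+ X]card_ord -sumr_const.
  apply: ler_sum => i _; rewrite normrM normrX ler_pM //.
  by rewrite ler_eXn2l // -ltnS.
rewrite exprS ler_pM2r ?exprn_gt0 ?(lt_trans _ z1) // => /le_trans; apply.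
by rewrite lerDr.
Qed.

Lemma open_finite_radius (R : realType) (n : nat) (I : set R) (r : 'I_n -> R) :
  open I -> (forall i, I (r i)) ->
  exists2 d : R, 0 < d & forall i z, `|z - r i| < d -> I z.
Proof.
move=> oI Ir.
have /fin_all_exists [d hd] : forall i, exists d : R, 0 < d /\ forall z, `|z - r i| < d -> I z.
  move=> i; have /= [e /= e0 he] := open_nbhs_nbhs (conj oI (Ir i)).
  by exists e; split => // z hz; apply: he; rewrite /ball_ /= distrC.
exists (\big[Num.min/1]_i d i).
  by apply: lt_bigmin => // i _; have [] := hd i.
by move=> i z /lt_le_trans h; have [_] := hd i; apply; apply: h; exact: bigmin_le.
Qed.

Lemma cvg_prod_cond (R : realType) (T : Type) (F : set_system T) (FF : Filter F)
    (n : nat) (P : pred 'I_n) (f : 'I_n -> T -> R) (l : 'I_n -> R) :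
  (forall i, P i -> f i t @[t --> F] --> l i) ->
  \prod_(i < n | P i) f i t @[t --> F] --> \prod_(i < n | P i) l i.
Proof. by move=> fl; apply: (cvg_big (@mul_continuous R)). Qed.

Lemma continuous_energy_product (R : realType) (n : nat) (W : R -> R) :
  continuous W -> continuous (fun v : 'rV[R]_n => energy_product W (v ord0)).
Proof.
move=> cW v.
have ci i : (u : 'rV[R]_n) ord0 i @[u --> v] --> v ord0 i by exact: coord_continuous.
have FF : Filter (nbhs v) by exact: nbhs_filter.
have cd i k : (u ord0 k - u ord0 i) ^+ 2 @[u --> v] --> (v ord0 k - v ord0 i) ^+ 2.
  by rewrite expr2; under eq_fun do rewrite expr2; apply: cvgM; apply: cvgB; exact: ci.
apply: cvgM.
  apply: (@cvg_prod_cond R _ (nbhs v) _ n xpredT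
    (fun i (u : 'rV[R]_n) => \prod_(k < n | k != i) (u ord0 k - u ord0 i) ^+ 2)) => i _.
  apply: (@cvg_prod_cond R _ (nbhs v) _ n (fun k => k != i)
    (fun k (u : 'rV[R]_n) => (u ord0 k - u ord0 i) ^+ 2)) => k _.
  exact: cd.
apply: (@cvg_prod_cond R _ (nbhs v) _ n xpredT (fun i (u : 'rV[R]_n) => W (u ord0 i) ^+ 2)) => i _.
rewrite expr2; under eq_fun do rewrite expr2.
by apply: cvgM; apply: cvg_comp (ci i) _; exact: cW.
Qed.

(** Bounded configurations have a cluster point as t tends to T from the left. Being a root, weak
    ordering and the lower bound on the energy product are closed conditions; the last one then
    makes the ordering strict. *)
Lemma increasing_roots_left_limit (R : realType) (n m : nat) (a : 'I_m -> R -> R)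
    (Y : 'I_m -> {poly R}) (X : R -> 'I_n -> R) (W : R -> R) (T M e : R) :
  (forall k, {for T, continuous (a k)}) -> continuous W -> 0 < e ->
  (\forall t \near T^'-, [/\ increasing_roots (\sum_k a k t *: Y k) (X t),
      forall i, `|X t i| <= M & e <= energy_product W (X t)]) ->
  exists2 r : 'I_n -> R, increasing_roots (\sum_k a k T *: Y k) r &
    0 < energy_product W r.
Proof.
move=> ca cW e0 hX.
pose row t : 'rV[R]_n := \row_i X t i.
have KK : compact [set v : 'rV[R]_n | forall i, `[- M, M]%classic (v ord0 i)].
  by apply: (@rV_compact R n (fun=> `[- M, M]%classic)) => i; exact: segment_compact.
have [|v [_ clv]] := KK (row @ T^'-) _.
  apply: filterS hX => t [_ XM _] i /=.
  by rewrite mxE in_itv /= -ler_norml.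
(* Every closed condition that holds just before T passes to the cluster point. *)
have clo (C : set 'rV[R]_n) : closed C -> (\forall t \near T^'-, C (row t)) -> C v.
  by move=> cC hC; apply: cC => B nB; exact: clv.
have ci i : continuous (fun u : 'rV[R]_n => u ord0 i) by move=> u; exact: coord_continuous.
have rowE t : row t ord0 = X t by apply/funext => i; rewrite mxE.
have Pv : e <= energy_product W (v ord0).
  apply: (clo [set u | e <= energy_product W (u ord0)]).
    apply: closed_comp (@closed_ge R e) => u _; exact: continuous_energy_product.
  by apply: filterS hX => t [_ _]; rewrite /= rowE.
have Pv0 := lt_le_trans e0 Pv.
exists (v ord0) => //; split.
  move=> i k ik.
  have : v ord0 i <= v ord0 k.
    rewrite -subr_ge0; apply: (clo [set u | 0 <= u ord0 k - u ord0 i]).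
      apply: closed_comp (@closed_ge R 0) => u _.
      have FF : Filter (nbhs u) := nbhs_filter u.
      exact: (cvgB (ci k u) (ci i u)).
    by apply: filterS hX => t [[ht _] _ _]; rewrite /= rowE subr_ge0 ltW // ht.
  (* Equal coordinates would put a zero factor into the energy product. *)
  rewrite le_eqVlt => /orP[/eqP E|//].
  have ki : k != i by apply: contraTneq ik => ->; rewrite ltnn.
  by move: Pv0; rewrite /energy_product (bigD1 i) //= (bigD1 k) //= E subrr expr0n /= !mul0r !ltxx.
(* At a root of the polynomial of time t, the polynomial of time T equals the difference of the two,
   which is uniformly small on |z| <= M. *)
move=> i; apply/rootP/eqP; rewrite -normr_le0; apply/ler_addgt0Pl => d d0.
rewrite addr0.
apply: (clo [set u | `|(\sum_k a k T *: Y k).[u ord0 i]| <= d]).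
  apply: closed_comp (@closed_le R d) => u _.
  have FF : Filter (nbhs u) := nbhs_filter u.
  exact: (cvg_norm (cvg_comp _ _ (ci i u) (@continuous_horner R _ _))).
have [b hb] : exists b : 'I_m -> R, forall k x, `|x| <= M -> `|(Y k).[x]| <= b k.
  by exists (fun k => sval (poly_disk_bound (Y k) M)) => k; case: poly_disk_bound.
have small : \forall t \near T^'-, \sum_k `|a k T - a k t| * b k < d.
  have : \sum_k `|a k T - a k t| * b k @[t --> T^'-] --> \sum_k `|a k T - a k T| * b k.
    apply: cvg_at_left_filter; apply: cvg_big => [|k _]; first exact: add_continuous.
    apply: cvgM; last exact: cvg_cst.
    by apply: cvg_norm; apply: cvgB; [exact: cvg_cst|exact: ca].
  under [X in _ --> X]eq_bigr do rewrite subrr normr0 mul0r.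
  by rewrite big1 // => /cvgr_lt; apply.
near=> t; rewrite /= rowE.
have [[_ Xr] XM _] : [/\ increasing_roots (\sum_k a k t *: Y k) (X t),
      forall i, `|X t i| <= M & e <= energy_product W (X t)] by near: t.
rewrite -[X in `|X|]subr0 -(rootP (Xr i)) !horner_sum -sumrB.
apply: le_trans (ler_norm_sum _ _ _) _.
apply: (@le_trans _ _ (\sum_k `|a k T - a k t| * b k)); last by apply: ltW; near: t.
apply: ler_sum => k _; rewrite !hornerZ -mulrBl normrM.
by apply: ler_wpM2l => //; exact: hb.
Unshelve. all: by end_near. Qed.

(** * The flow of the roots *)

(* Normalized so that the coefficient of Y n is constant, which keeps it monic. *)
Definition evolution {R : realType} (lambda c : nat -> R) (Y : nat -> {poly R}) (n : nat)
    (t : R) : {poly R} :=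
  \sum_(k < n.+1) (c k * expR ((lambda k - lambda n) * t)) *: Y k.

Lemma evolution_split (R : realType) (lambda c : nat -> R) (Y : nat -> {poly R}) n t :
  evolution lambda c Y n t =
  \sum_(k < n) (c k * expR ((lambda k - lambda n) * t)) *: Y k + c n *: Y n.
Proof. by rewrite /evolution big_ord_recr /= subrr mul0r expR0 mulr1. Qed.

Lemma size_monic_lead (R : realType) (n : nat) (P Q : {poly R}) :
  (size Q <= n)%N -> size P = n.+1 ->
  size (Q + P) = n.+1 /\ ((Q + P \is monic) = (P \is monic)).
Proof.
move=> sQ sP; have lt : (size Q < size P)%N by rewrite sP ltnS.
by rewrite addrC size_polyDl // !monicE lead_coefDl.
Qed.

Lemma size_sum_lower (R : realType) (Y : nat -> {poly R}) (b : nat -> R) n :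
  (forall k, size (Y k) = k.+1) -> (size (\sum_(k < n) b k *: Y k)%R <= n)%N.
Proof.
move=> sY; apply: (leq_trans (size_sum _ _ _)); apply/bigmax_leqP => k _.
by apply: leq_trans (size_scale_leq _ _) _; rewrite sY.
Qed.

(** The term of degree n does not depend on t, and the others have lower degree; so size and leading
    coefficient at time 0 persist. *)
Lemma evolution_monic (R : realType) (lambda c : nat -> R) (Y : nat -> {poly R}) n :
  (forall k, size (Y k) = k.+1) ->
  size (evolution lambda c Y n 0) = n.+1 -> evolution lambda c Y n 0 \is monic ->
  [/\ size (c n *: Y n) = n.+1, c n *: Y n \is monic &
      forall t, size (evolution lambda c Y n t) = n.+1 /\ evolution lambda c Y n t \is monic].
Proof.
move=> sY s0 m0.
have low t : (size (\sum_(k < n) (c k * expR ((lambda k - lambda n) * t)) *: Y k)%R <= n)%N.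
  exact: (size_sum_lower _ _ (fun k => c k * expR ((lambda k - lambda n) * t))).
have sc : size (c n *: Y n) = n.+1.
  have c0 : c n != 0.
    apply: contra_eq_neq s0 => c0.
    rewrite evolution_split c0 scale0r addr0 ltn_eqF // ltnS; exact: low.
  by rewrite size_scale.
have mc : c n *: Y n \is monic.
  by move: m0; rewrite evolution_split (size_monic_lead _ _ _ _ (low 0) sc).2.
split => // t; rewrite evolution_split.
by have [-> ->] := size_monic_lead _ _ _ _ (low t) sc.
Qed.

Lemma increasing_eigenvalues (R : realType) (lambda : nat -> R) :
  (forall j, lambda j < lambda j.+1) -> {homo lambda : j k / (j <= k)%N >-> j <= k}.
Proof. by move=> lamS; apply: homo_leq le_trans _ => // j; exact: ltW. Qed.

(** The eigenvalues increase, so among the decaying terms k < n the slowest is k = n - 1. *)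
Lemma evolution_bound (R : realType) (lambda c : nat -> R) (Y : nat -> {poly R}) n (t z : R) :
  (forall j, lambda j < lambda j.+1) -> 0 <= t ->
  `|(c n *: Y n).[z] - (evolution lambda c Y n t).[z]| <=
  (\sum_(k < n) `|c k| * `|(Y k).[z]|) * expR (- (lambda n - lambda n.-1) * t).
Proof.
move=> /increasing_eigenvalues lamS t0.
rewrite evolution_split hornerD opprD addrCA subrr addr0 normrN horner_sum mulr_suml.
apply: le_trans (ler_norm_sum _ _ _) _; apply: ler_sum => k _.
rewrite hornerZ !normrM (ger0_norm (expR_ge0 _)) -!mulrA ler_wpM2l // mulrC ler_wpM2l //.
rewrite ler_expR ler_wpM2r // opprB lerD2r lamS //.
by case: n k => [[]|n] // k; rewrite -ltnS.
Qed.

Lemma evolution_cvgy (R : realType) (lambda c : nat -> R) (Y : nat -> {poly R}) n z :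
  (0 < n)%N -> (forall j, lambda j < lambda j.+1) ->
  (evolution lambda c Y n t).[z] @[t --> +oo] --> (c n *: Y n).[z].
Proof.
move=> n0 lamS.
have s0 : 0 < lambda n - lambda n.-1.
  by rewrite subr_gt0; have := lamS n.-1; rewrite prednK.
set s := lambda n - lambda n.-1 in s0 *.
set C := \sum_(k < n) `|c k| * `|(Y k).[z]|.
apply/cvgrPdist_lt => e e0; near=> t.
have t0 : 0 <= t by near: t; exact: nbhs_pinfty_ge.
apply: le_lt_trans (evolution_bound _ _ _ _ _ _ _ lamS t0) _; rewrite -/s -/C.
have st : 0 < 1 + s * t by have := mulr_ge0 (ltW s0) t0; lra.
have C0 : 0 <= C by apply: sumr_ge0 => k _; rewrite mulr_ge0.
(* This threshold gives C < e s t, and 1 + s t <= exp(s t) then brings the bound below e. *)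
have big : C / e / s < t by near: t; apply: nbhs_pinfty_gt; exact: num_real.
rewrite mulNr expRN ltr_pdivrMr ?expR_gt0 //.
apply: lt_le_trans (_ : e * (1 + s * t) <= _); last first.
  by rewrite ler_wpM2l ?(ltW e0) // expR_ge1Dx.
have : C < e * (s * t).
  by move: big; rewrite !ltr_pdivrMr // => h; rewrite mulrC; nra.
nra.
Unshelve. all: by end_near. Qed.

(** For t >= 0 all exponentials are at most 1, so the coefficients are bounded uniformly in time. *)
Lemma evolution_root_bound (R : realType) (lambda c : nat -> R) (Y : nat -> {poly R}) n :
  (forall j, lambda j < lambda j.+1) -> (forall k, size (Y k) = k.+1) ->
  (forall t, size (evolution lambda c Y n t) = n.+1 /\ evolution lambda c Y n t \is monic) ->
  exists M, forall t z, 0 <= t -> root (evolution lambda c Y n t) z -> `|z| <= M.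
Proof.
move=> lamS sY hU.
pose B := \sum_(k < n.+1) \sum_(i < n.+1) `|c k| * `|(Y k)`_i|.
exists (1 + n%:R * B) => t z t0.
have [sU mU] := hU t; apply: monic_root_bound => // i.
have [ni|ni] := ltnP n i.
  by rewrite nth_default ?sU // normr0; do 2!(apply: sumr_ge0 => ? _); rewrite mulr_ge0.
rewrite coef_sum; apply: le_trans (ler_norm_sum _ _ _) _; apply: ler_sum => k _.
have hi : (i < n.+1)%N by [].
rewrite (bigD1 (Ordinal hi)) //= coefZ !normrM -[leLHS]addr0 lerD //; last first.
  by apply: sumr_ge0 => ? _; rewrite mulr_ge0.
rewrite ler_wpM2r // -[leRHS]mulr1 ler_wpM2l // ger0_norm ?expR_ge0 //.
rewrite -expR0 ler_expR mulr_le0_ge0 // subr_le0 (increasing_eigenvalues _ _ lamS) //.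
by rewrite -ltnS.
Qed.

Lemma eigen_sum_equation (R : realType) (p q : {poly R}) (m : nat) (a mu : 'I_m -> R)
    (Y : 'I_m -> {poly R}) (z : R) :
  (forall k, (- (p * (Y k)^`())^`() + q * (Y k)^`()).[z] = mu k * (Y k).[z]) ->
  let U := \sum_k a k *: Y k in
  \sum_k a k * mu k * (Y k).[z] = (- (p * U^`())^`() + q * U^`()).[z].
Proof.
move=> hY U.
have -> : - (p * U^`())^`() + q * U^`() =
    \sum_k a k *: (- (p * (Y k)^`())^`() + q * (Y k)^`()).
  rewrite /U raddf_sum /= !mulr_sumr raddf_sum /= -sumrN -big_split /=.
  by apply: eq_bigr => k _; rewrite derivZ -!scalerAr derivZ scalerDr scalerN.
by rewrite horner_sum; apply: eq_bigr => k _; rewrite hornerZ hY mulrA.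
Qed.

Lemma is_derive_expR_scale (R : realType) (c m t : R) :
  is_derive t 1 (fun s => c * expR (m * s)) (c * expR (m * t) * m).
Proof.
have h1 : is_derive t 1 (fun s : R => m * s) m.
  by apply: is_derive_eq (is_deriveZ m (is_derive_id t (1 : R))) _;
    rewrite /= -[_ *: _]/(_ * _) mulr1.
apply: is_derive_eq (is_deriveZ c (is_derive1_comp (is_derive_expR (m * t)) h1)) _.
by rewrite /= -[_ *: _]/(_ * _) mulrA.
Qed.

Lemma continuous_expR_scale (R : realType) (c m : R) :
  continuous (fun s => c * expR (m * s)).
Proof.
move=> t; apply/differentiable_continuous/derivable1_diffP.
by have [] := is_derive_expR_scale _ c m t.
Qed.

Lemma evolution_horner_continuous (R : realType) (lambda c : nat -> R)
    (Y : nat -> {poly R}) n z :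
  continuous (fun t => (evolution lambda c Y n t).[z]).
Proof.
move=> t; rewrite /evolution /continuous_at horner_sum.
under eq_fun do rewrite horner_sum.
apply: cvg_big => [|k _]; first exact: add_continuous.
rewrite hornerZ; under eq_fun do rewrite hornerZ.
by apply: cvgM; [exact: continuous_expR_scale|exact: cvg_cst].
Qed.

(** Writing U for the evolution, a root moves with velocity - U_t / U'. The eigenvalue equations
    give U_t = - (p U')' + q U' - lambda_n U, whose last term vanishes at the root, and U'' / U' is
    minus the interaction sum. *)
Lemma is_derive_evolution_root (R : realType) (p q : {poly R}) (lambda c : nat -> R)
    (Y : nat -> {poly R}) n (X : R -> 'I_n -> R) t i :
  (forall k, (- (p * (Y k)^`())^`() + q * (Y k)^`()).[X t i] = lambda k * (Y k).[X t i]) ->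
  {for t, continuous (fun s => X s i)} ->
  (\forall s \near t, increasing_roots (evolution lambda c Y n s) (X s)) ->
  evolution lambda c Y n t = \prod_(k < n) ('X - (X t k)%:P) ->
  is_derive t 1 (fun s => X s i)
    (- p.[X t i] * (\sum_(k < n | k != i) 2 / (X t k - X t i))
           + p^`().[X t i] - q.[X t i]).
Proof.
move=> hY cX rX UE.
have [ht rt] := nbhs_singleton rX.
have /= [U1 U2] := deriv2_prod_XsubC_root _ _ (X t) i (increasing_neq _ _ _ ht i).
rewrite -UE in U1 U2.
have hr : \forall s \near t, root (evolution lambda c Y n s) (X s i).
  by apply: filterS rX => s [].
apply: is_derive_eq (is_derive_root _ _ _ _ _ _ _
  (fun k : 'I_n.+1 => is_derive_expR_scale _ (c k) (lambda k - lambda n) t) cX hr U1) _.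
rewrite -/(evolution lambda c Y n t).
set g := X t i in hY U1 U2 *; set U := evolution _ _ _ _ _ in UE U1 U2 *.
have -> : \sum_(k < n.+1) c k * expR ((lambda k - lambda n) * t) * (lambda k - lambda n) * (Y k).[g]
   = (- (p * U^`())^`() + q * U^`()).[g].
  rewrite -(eigen_sum_equation _ _ _ _ _ (fun k : 'I_n.+1 => lambda k)) //.
  have -> : \sum_(k < n.+1) c k * expR ((lambda k - lambda n) * t) *
        (lambda k - lambda n) * (Y k).[g] =
      \sum_(k < n.+1) c k * expR ((lambda k - lambda n) * t) * lambda k * (Y k).[g] -
      lambda n * U.[g].
    rewrite /U /evolution horner_sum mulr_sumr -sumrB; apply: eq_bigr => k _.
    by rewrite hornerZ; ring.
  by rewrite (rootP (rt i)) mulr0 subr0.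
rewrite hornerD hornerN derivM hornerD !hornerM U2.
by field.
Qed.

(** A continuation argument: having n ordered roots in I is an open condition in time, and the
    energy product shows that it cannot first fail at a positive time. *)
Lemma evolution_flow (R : realType) (p q : {poly R}) (I : set R) (w W : R -> R)
    (lambda c : nat -> R) (Y : nat -> {poly R}) n (x0 : 'I_n -> R) :
  open I -> (forall x, I x -> 0 < p.[x]) -> sl_weight p q I w ->
  continuous W -> (forall x, I x -> W x = p.[x] * w x) -> (forall x, ~ I x -> W x = 0) ->
  (forall j, lambda j < lambda j.+1) -> (forall k, size (Y k) = k.+1) ->
  (forall k x, I x -> (- (p * (Y k)^`())^`() + q * (Y k)^`()).[x] = lambda k * (Y k).[x]) ->
  (forall i k : 'I_n, (i < k)%N -> x0 i < x0 k) -> (forall i, I (x0 i)) ->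
  evolution lambda c Y n 0 = \prod_(i < n) ('X - (x0 i)%:P) ->
  exists X : 'I_n -> R -> R, zero_flow p q I x0 X /\
    forall t, 0 <= t -> increasing_roots (evolution lambda c Y n t) (X^~ t).
Proof.
move=> oI p0 hw cW WI W0 lamS sY eigY x0i x0I U0E.
set U := evolution lambda c Y n in U0E *.
have [_ _ hU] : [/\ size (c n *: Y n) = n.+1, c n *: Y n \is monic &
      forall t, size (U t) = n.+1 /\ U t \is monic].
  apply: evolution_monic => //; rewrite -/U U0E ?monic_prod_XsubC //.
  by rewrite -big_enum size_prod_XsubC size_enum_ord.
pose good (t : R) (r : 'I_n -> R) := increasing_roots (U t) r /\ forall i, I (r i).
have good_unique t r s : good t r -> good t s -> r = s.
  move=> [hr _] [hs _]; have [sU mU] := hU t.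
  exact: increasing_roots_unique sU mU hr hs.
have good_near t r e : good t r -> 0 < e ->
    \forall s \near t, exists2 r', good s r' & forall i, `|r' i - r i| < e.
  move=> [hr Ir] e0; have [sU mU] := hU t.
  have [d d0 hd] := open_finite_radius _ _ _ _ oI Ir.
  (* A displacement below d keeps every root inside I. *)
  have m0 : 0 < Num.min e d by rewrite lt_min e0 d0.
  have := increasing_roots_perturb _ _ _ _ _ (nbhs_filter t) U r _ sU mU hr
    (fun z => evolution_horner_continuous _ _ _ _ _ z t) m0.
  apply: filterS => s [r' hr' near]; exists r'; last first.
    by move=> i; have := near i; rewrite lt_min => /andP[].
  split => // i; apply: (hd i).
  by have := near i; rewrite lt_min => /andP[].
(* A good configuration is chosen wherever one exists; elsewhere the value is an arbitrary 0. By
   uniqueness the choice inherits continuity from the perturbation lemma. *)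
have /choice [X hX] : forall t, exists r, (exists s, good t s) -> good t r.
  move=> t; have [[r hr]|no] := pselect (exists r, good t r); first by exists r.
  by exists (fun=> 0).
have nearX t e : good t (X t) -> 0 < e ->
    \forall s \near t, good s (X s) /\ forall i, `|X s i - X t i| < e.
  move=> gt e0; apply: filterS (good_near t _ e gt e0) => s [r gr near].
  have gs : good s (X s) by apply: hX; exists r.
  by rewrite (good_unique _ _ _ gs gr).
have contX t i : good t (X t) -> {for t, continuous (fun s => X s i)}.
  move=> gt; apply/cvgrPdist_lt => e e0.
  apply: filterS (nearX t e gt e0) => s [_ /(_ i)].
  by rewrite distrC.
have derX t i : good t (X t) -> is_derive t 1 (fun s => X s i)
    (- p.[X t i] * (\sum_(k < n | k != i) 2 / (X t k - X t i))
           + p^`().[X t i] - q.[X t i]).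
  move=> gt; have [hr Ir] := gt; have [sU mU] := hU t.
  apply: (is_derive_evolution_root _ p q lambda c Y) => [k|||].
  - exact: eigY.
  - exact: contX.
  - by apply: filterS (nearX t 1 gt ltr01) => s [[]].
  - exact: monic_roots_prod sU mU hr.
have good0 : good 0 x0.
  split=> //; split=> // i; rewrite U0E /root horner_prod (bigD1 i) //=.
  by rewrite hornerXsubC subrr mul0r.
have X0 : X 0 = x0 by apply: (good_unique 0) => //; apply: hX; exists x0.
have [M hM] := evolution_root_bound _ _ c _ n lamS sY hU.
have goodX t : 0 <= t -> good t (X t).
  apply: contraPP => bad t0.
  pose B := [set s | 0 <= s /\ ~ good s (X s)].
  have Blb : has_lbound B by exists 0 => s [].
  have Binf : has_inf B by split => //; exists t.
  pose T := inf B.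
  have T0 : 0 <= T by apply: lb_le_inf; [exists t|move=> s []].
  have below s : 0 <= s < T -> good s (X s).
    move=> /andP[s0 sT]; apply: contrapT => bs.
    have : T <= s by apply: ge_inf.
    by rewrite leNgt sT.
  (* If T were good, so would be a neighbourhood, yet bad times lie arbitrarily close to their
     infimum. *)
  have badT : ~ good T (X T).
    move=> gT; have /= [e /= e0 he] := nearX T 1 gT ltr01.
    have [s [s0 bs] sT] := inf_adherent e0 Binf.
    have Ts : T <= s by apply: ge_inf.
    have [] := he s; last by [].
    by rewrite /ball_ /= distrC ger0_norm ?subr_ge0 //; rewrite -/T in sT; lra.
  have Tpos : 0 < T.
    rewrite lt_neqAle T0 andbT; apply/eqP => E; apply: badT.
    by rewrite -E X0.
  (* The initial energy product is positive and bounds the later ones from below up to T. *)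
  pose P0 := energy_product W x0.
  have Pgood s r : good s r -> 0 < energy_product W r.
    move=> [[ri _] Ir]; apply: mulr_gt0.
      apply: prodr_gt0 => i _; apply: prodr_gt0 => k ki.
      by rewrite exprn_even_gt0 //= subr_eq0 increasing_neq.
    apply: prodr_gt0 => i _; rewrite exprn_even_gt0 //= WI //.
    by rewrite mulf_neq0 ?gt_eqF ?p0 //; have [] := hw _ (Ir i).
  apply: badT; apply: hX.
  have [|r hr Pr] := increasing_roots_left_limit _ n n.+1
      (fun k s => c k * expR ((lambda k - lambda n) * s)) (fun k => Y k) X W T M P0
      (fun k => continuous_expR_scale _ _ _ _) cW (Pgood 0 _ good0).
    have nT : \forall s \near T^'-, 0 <= s < T.
      near=> s; apply/andP; split; last by near: s; exact: nbhs_left_lt.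
      by near: s; exact: nbhs_left_ge.
    apply: filterS nT => s hs; have gs := below s hs; split.
    - by have [] := gs.
    - by move=> i; have /andP[s0 _] := hs; apply: hM s0 _; have [[]] := gs.
    - rewrite /P0 -X0.
      apply: (energy_product_nondecreasing _ n p q I w W (fun i s => X s i) T s) => //.
      + by move=> s' i /below [].
      + by move=> s' i k /below [[ri _] _]; exact: increasing_neq.
      + by move=> s' i /below; exact: derX.
  (* A limit root outside I would make its W factor, hence the whole product, vanish. *)
  exists r; split => // i; apply: contrapT => nI.
  by move: Pr; rewrite /energy_product [X in _ * X](bigD1 i) //= W0 // expr0n /= mul0r mulr0 ltxx.
exists (fun i t => X t i); split; last by move=> t /goodX [].
split.
- by move=> i; rewrite X0.
- move=> i; apply: continuous_in_subspaceT => t; rewrite inE /= in_itv /= andbT => t0.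
  by apply: contX; exact: goodX.
- by move=> t i /goodX [].
- by move=> t i k /goodX [[ri _] _]; exact: increasing_neq.
- by move=> t i t0; apply: derX; apply: goodX; exact: ltW.
Unshelve. all: by end_near. Qed.

(** * Convergence and its rate *)

(** Let A be the monic limit polynomial. Once the roots are within d / 2 of their limits, |A(X_i)|
    is at least |X_i - x_i| (d / 2)^(n-1); as the evolution vanishes at X_i, |A(X_i)| is also at
    most a constant times the decaying exponential. *)
Lemma evolution_roots_rate (R : realType) (lambda c : nat -> R) (Y : nat -> {poly R})
    (n : nat) (x : 'I_n -> R) (X : 'I_n -> R -> R) :
  (0 < n)%N -> (forall j, lambda j < lambda j.+1) -> (forall k, size (Y k) = k.+1) ->
  size (evolution lambda c Y n 0) = n.+1 -> evolution lambda c Y n 0 \is monic ->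
  increasing_roots (Y n) x ->
  (forall t, 0 <= t -> increasing_roots (evolution lambda c Y n t) (X^~ t)) ->
  (forall i, X i t @[t --> +oo] --> x i) /\
  exists2 C : R, 0 < C & forall t i, 0 <= t ->
    `|X i t - x i| <= C * expR (- (lambda n - lambda n.-1) * t).
Proof.
move=> n0 lamS sY s0 m0 [xi xr] rX.
have [sA mA hU] := evolution_monic _ _ _ _ _ sY s0 m0.
set U := evolution lambda c Y n in s0 m0 rX hU *.
have hx : increasing_roots (c n *: Y n) x.
  by split => // i; rewrite /root hornerZ (rootP (xr i)) mulr0.
have close e : 0 < e -> \forall t \near +oo, forall i, `|X i t - x i| < e.
  move=> e0; near=> t.
  have t0 : 0 <= t by near: t; exact: nbhs_pinfty_ge.
  have [s rs sx] : exists2 s : 'I_n -> R, increasing_roots (U t) s & forall i, `|s i - x i| < e.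
    near: t; apply: increasing_roots_perturb sA mA hx _ e0 => z.
    exact: evolution_cvgy.
  have [sU mU] := hU t.
  have E := increasing_roots_unique _ _ _ _ _ sU mU (rX t t0) rs.
  by move=> i; rewrite -[X i t]/((X^~ t) i) E.
split.
  move=> i; apply/cvgrPdist_lt => e e0.
  by apply: filterS (close e e0) => t /(_ i); rewrite distrC.
set s := lambda n - lambda n.-1.
have [M hM] := evolution_root_bound _ _ c _ n lamS sY hU.
have [d d0 hd] := increasing_gap _ _ _ xi.
have d20 : 0 < d / 2 by lra.
have [T [_ hT]] := close _ d20.
have [b hb] : exists b : nat -> R, forall k z, `|z| <= M -> `|(Y k).[z]| <= b k.
  by exists (fun k => sval (poly_disk_bound (Y k) M)) => k; case: poly_disk_bound.
pose C1 := \sum_(k < n) `|c k| * b k.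
(* This constant handles t <= T, where only boundedness of the roots is available: its exponential
   factor offsets the decay up to T. *)
pose C2 := (M + \sum_(i < n) `|x i|) * expR (`|s| * `|T|).
have s_ge0 : 0 <= s by rewrite subr_ge0; apply: increasing_eigenvalues => //; exact: leq_pred.
exists (1 + `|C1 / (d / 2) ^+ n.-1| + `|C2|); first by rewrite !ltr_wpDr.
move=> t i t0; rewrite !mulrDl.
have e_ge0 : 0 <= expR (- s * t) by exact: expR_ge0.
have [_ rXt] := rX t t0.
have XM : `|X i t| <= M by exact: hM t0 (rXt i).
have [tT|Tt] := leP t T.
  apply: (@le_trans _ _ (C2 * expR (- s * t))); last first.
    have := ler_wpM2r e_ge0 (ler_norm C2).
    have := mulr_ge0 (normr_ge0 (C1 / (d / 2) ^+ n.-1)) e_ge0.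
    by lra.
  have M0 : 0 <= M + \sum_(i < n) `|x i|.
    by rewrite addr_ge0 ?sumr_ge0 // (le_trans _ XM).
  apply: (@le_trans _ _ (M + \sum_(i < n) `|x i|)).
    apply: le_trans (ler_normB _ _) _; apply: lerD => //.
    by rewrite (bigD1 i) //= lerDl sumr_ge0.
  rewrite -mulrA -expRD -[leLHS]mulr1 ler_wpM2l // -expR0 ler_expR.
  have : s * t <= `|s| * `|T|.
    by apply: ler_pM => //; [exact: ler_norm|exact: le_trans tT (ler_norm _)].
  by lra.
apply: (@le_trans _ _ (C1 / (d / 2) ^+ n.-1 * expR (- s * t))); last first.
  have := ler_wpM2r e_ge0 (ler_norm (C1 / (d / 2) ^+ n.-1)).
  have := mulr_ge0 (normr_ge0 C2) e_ge0.
  by lra.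
rewrite mulrAC ler_pdivlMr ?exprn_gt0 //.
apply: (@le_trans _ _ `|(c n *: Y n).[X i t]|).
  rewrite (monic_roots_prod _ _ _ _ sA mA hx) horner_prod normr_prod (bigD1 i) //=.
  rewrite hornerXsubC ler_wpM2l //.
  (* Besides the i-th there are n - 1 factors, each at least d - d / 2. *)
  have -> : (d / 2) ^+ n.-1 = \prod_(k < n | k != i) (d / 2).
    by rewrite prodr_const cardC1 card_ord.
  apply: ler_prod => k ki; rewrite ltW //= hornerXsubC.
  have h1 := hd _ _ ki; have h2 := hT t Tt i.
  have : `|x k - x i| <= `|X i t - x k| + `|X i t - x i|.
    rewrite -[`|X i t - x k|]normrN opprB.
    rewrite (_ : x k - x i = (x k - X i t) + (X i t - x i)); last by ring.
    exact: ler_normD.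
  lra.
rewrite -[_.[_]]subr0 -(rootP (rXt i)).
apply: le_trans (evolution_bound _ _ _ _ _ _ _ lamS t0) _.
rewrite ler_wpM2r //; apply: ler_sum => k _.
by rewrite ler_wpM2l // hb.
Unshelve. all: by end_near. Qed.

Theorem theorem2 (R : realType) (p q : {poly R}) (I : set R)
    (lambda : nat -> R) (y : nat -> R -> R) (n : nat) (x : 'I_n -> R)
    (hp : (size p <= 3)%N) (hq : (size q <= 2)%N)
    (hI : open_interval I)
    (hSL : sturm_liouville p q I lambda y)
    (hpoly : forall j, polynomial_of_degree_on I j (y j))
    (hn : (1 <= n)%N)
    (hx_incr : forall i k : 'I_n, (i < k)%N -> x i < x k)
    (hx_zeros : range x = [set z | I z /\ y n z = 0]) :
  exists2 sigma : R, lambda n - lambda n.-1 <= sigma &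
    forall x0 : 'I_n -> R,
      (forall i k : 'I_n, (i < k)%N -> x0 i < x0 k) ->
      (forall i, I (x0 i)) ->
      exists X : 'I_n -> R -> R,
        [/\ zero_flow p q I x0 X,
            forall i, X i t @[t --> +oo] --> x i &
            exists2 c : R, 0 < c &
              forall t : R, 0 <= t ->
                \big[Num.max/0]_(i < n) `|X i t - x i| <=
                c * expR (- sigma * t)].
Proof.
have [w [W [hw cW WI W0]]] := weight_extension _ _ _ _ _ _ hI hSL hpoly.
have [oI _ _] := hI.
have [p0 _ lamS sol _] := hSL.
have [Y hY] := choice hpoly.
have sY j : size (Y j) = j.+1 by have [] := hY j.
have yY j z : I z -> y j z = (Y j).[z] by have [_] := hY j; apply.
(* The rate is the spectral gap itself, chosen before the initial values. *)
exists (lambda n - lambda n.-1) => // x0 x0i x0I.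
have s0 : size (\prod_(i < n) ('X - (x0 i)%:P)) = n.+1.
  by rewrite -big_enum size_prod_XsubC size_enum_ord.
have [c hc] : exists c : nat -> R, \prod_(i < n) ('X - (x0 i)%:P) = \sum_(k < n.+1) c k *: Y k.
  by apply: poly_graded_basis => //; rewrite s0.
have U0E : evolution lambda c Y n 0 = \prod_(i < n) ('X - (x0 i)%:P).
  by rewrite hc; apply: eq_bigr => k _; rewrite mulr0 expR0 mulr1.
have [X [flow roots]] := evolution_flow _ _ _ _ _ _ _ _ _ _ _ oI p0 hw cW WI W0 lamS sY
  (fun k z Iz => polynomial_eigen_equation _ _ _ _ _ _ _ oI (sol k) (yY k) z Iz) x0i x0I U0E.
have hx : increasing_roots (Y n) x.
  split => // i; have : range x (x i) by exists i.
  by rewrite hx_zeros => -[Ix yx]; rewrite /root -yY // yx.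
have [||lim [C C0 hC]] := evolution_roots_rate _ lambda c Y n x X hn lamS sY _ _ hx roots.
- by rewrite U0E.
- by rewrite U0E monic_prod_XsubC.
exists X; split => //; exists C => // t t0.
apply: bigmax_le => [|i _]; last exact: hC.
by rewrite mulr_ge0 ?expR_ge0 // ltW.
Qed.
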